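(* Let $G$ be a finite group. If there exists an element $x\in G$ such that the elements of $\mathsf{Sol}_G(x)$ commute pairwise, then $G$ is abelian.
   Context: All groups are finite. For an element $x$ of a group $G$, the solubilizer of $x$ in $G$ is the set $\mathsf{Sol}_G(x)=\{g\in G \mid \langle x,g\rangle \text{ is soluble}\}$; it need not be a subgroup of $G$. *)

(* Defs.v *)
From mathcomp Require Import all_boot all_fingroup all_solvable.

Set Implicit Arguments.
Unset Strict Implicit.
Unset Printing Implicit Defensive.

Import GroupScope.

Definition solubilizer (gT : finGroupType) (G : {set gT}) (x : gT) : {set gT} :=
  [set g in G | solvable <<[set x; g]>>].

(* Main.v *)
(** Let [A] be the centraliser of [x], where [x] has a pairwise commuting
    solubilizer.  Every soluble subgroup containing [x] lies in the
    solubilizer, hence in [A].  In a minimal nonabelian counterexample, proper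
    subgroups containing [x] are abelian, so [A] is an abelian maximal subgroup
    and it suffices that such a group is soluble.  If [A] is not normal, two
    distinct conjugates of [A] generate [G] and so meet in ['Z(G)]; thus
    [G / 'Z(G)] is a Frobenius group with complement [A / 'Z(G)].  Its kernel
    has an [A]-invariant Sylow [p]-subgroup for each [p], which by maximality is
    the whole kernel, so the kernel is a [p]-group. *)
Require Import Defs.
From mathcomp Require Import all_boot all_fingroup all_solvable all_character.

Set Implicit Arguments.
Unset Strict Implicit.
Unset Printing Implicit Defensive.

Import GroupScope.

Lemma Frobenius_maximal_sol (gT : finGroupType) (G K H : {group gT}) :
  [Frobenius G = K ><| H] -> maximal H G -> solvable H -> solvable G.
Proof.
move=> frobG /maxgroupP[_ maxH] solH.
have [defG ntK _ _ _] := Frobenius_context frobG.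
have [nsKG sHG defKH nKH tiKH] := sdprod_context defG.
have coKH := Frobenius_coprime frobG.
have [P sylP nPH] := sol_coprime_Sylow_exists (pdiv #|K|) solH nKH coKH.
have [sPK pP _] := and3P sylP.
have ntP : P :!=: 1.
  rewrite -cardG_gt1 (card_Hall sylP) p_part_gt1 mem_primes.
  by rewrite pdiv_prime ?cardG_gt1 // cardG_gt0 pdiv_dvd.
have sPHG : P <*> H \subset G.
  by rewrite join_subG sHG (subset_trans sPK) ?normal_sub.
(* Were [P <*> H] proper, maximality would put [P] inside [H], hence inside [K :&: H = 1]. *)
have defPH : P <*> H = G.
  apply/eqP; rewrite eqEproper sPHG; apply: contra ntP => prPH.
  have /= eqH := maxH (P <*> H)%G prPH (joing_subr _ _).
  rewrite -subG1 -tiKH subsetI sPK -[in X in _ \subset X]eqH.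
  exact: joing_subl.
have nsPG : P <| G by rewrite -defPH normalYl.
rewrite (series_sol nsPG) (pgroup_sol pP) -defPH norm_joinEr // quotientMidl.
exact: quotient_sol.
Qed.

(** Any [g] of [G] outside [H] generates [G] modulo [H], so [G / H] is cyclic. *)
Lemma normal_maximal_sol (gT : finGroupType) (G H : {group gT}) :
  H <| G -> maximal H G -> solvable H -> solvable G.
Proof.
move=> nsHG maxH solH; have /properP[_ [g Gg notHg]] := maxgroupp maxH.
have defG : H * <[g]> = G.
  by apply: mulg_normal_maximal; rewrite ?cycle_subG.
rewrite (series_sol nsHG) solH -defG quotientMidl quotient_sol //.
exact/abelian_sol/cycle_abelian.
Qed.

Lemma abelian_maximal_sol (gT : finGroupType) (G A : {group gT}) :
  maximal A G -> abelian A -> solvable G.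
Proof.
move=> maxA cAA; have solA := abelian_sol cAA.
have /maxgroupP[prAG maxAH] := maxA; have sAG := proper_sub prAG.
have [nsAG | not_nsAG] := boolP (A <| G).
  exact: normal_maximal_sol nsAG maxA solA.
have genG (B : {group gT}) : B \subset G -> ~~ (B \subset A) -> A <*> B = G.
  move=> sBG notsBA; apply/eqP; rewrite eqEproper join_subG sAG sBG /=.
  apply: contra notsBA => prAB.
  have /= eqA := maxAH (A <*> B)%G prAB (joing_subl _ _).
  by rewrite -[in X in _ \subset X]eqA joing_subr.
(* Otherwise [A] and ['N_G(A)], which both normalise [A], would generate [G]. *)
have sNA : 'N_G(A) \subset A.
  apply: contraR not_nsAG => /genG; rewrite subsetIl => /(_ isT) defG.
  by rewrite /normal sAG -[in X in X \subset _]defG join_subG normG subsetIr.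
have sZA : 'Z(G) \subset A.
  apply: subset_trans sNA; rewrite subsetI center_sub.
  by rewrite (subset_trans (subsetIr _ _)) // cents_norm ?centS.
have nsZG := center_normal G; have nsZA := normalS sZA sAG nsZG.
have maxAq : maximal (A / 'Z(G)) (G / 'Z(G)) by rewrite quotient_maximal.
have solAq := quotient_sol 'Z(G) solA.
have frobG : [Frobenius G / 'Z(G) with complement A / 'Z(G)].
  rewrite /Frobenius_group_with_complement.
  rewrite (proper_neq (maxgroupp maxAq)) /=; apply/normedTI_P; split.
  - rewrite setD_eq0 subG1 -subG1 quotient_sub1 ?normal_norm //.
    apply: contra not_nsAG => sAZ.
    by have /eqP <- : 'Z(G) == A by rewrite eqEsubset sZA.
  - by rewrite normD1 subsetI normG quotientS ?sAG.
  (* By contraposition: if the image of [g] is outside [A / 'Z(G)], a coset common to [A / 'Z(G)]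
     and its conjugate by [g] is trivial. *)
  move=> _ /morphimP[g nZg Gg ->].
  rewrite -setI_eq0 => /set0Pn[xb /setIP[/setD1P[ntxb]]].
  rewrite conjD1g => Axb /setD1P[_]; apply: contraLR => notAg.
  case/morphimP: Axb ntxb => x nZx Ax -> ntx.
  apply: contra ntx; rewrite -quotientJ // => Agx.
  (* Membership lifts from the quotient because [A :^ g] also contains ['Z(G)]. *)
  have Agx' : x \in A :^ g.
    have nsZAg : 'Z(G) <| A :^ g by rewrite -(normP nZg) normalJ.
    by rewrite -(quotientGK nsZAg) mem_morphpre.
  have notsAg : ~~ (A :^ g \subset A).
    apply: contra notAg => sAgA; rewrite mem_morphim // (subsetP sNA) //.
    by rewrite !inE Gg.
  have sAgG : A :^ g \subset G by rewrite conj_subG.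
  (* Lying in the abelian groups [A] and [A :^ g], [x] centralises both, hence the group [G] they
     generate. *)
  apply/eqP/coset_id.
  rewrite inE (subsetP sAG) //= -(genG (A :^ g)%G) //= centY inE.
  by rewrite (subsetP cAA) //= centJ mem_conjg (subsetP cAA) // -mem_conjg.
have [K frobK] := Frobenius_kernel_exists frobG.
rewrite (series_sol nsZG) (abelian_sol (center_abelian G)).
exact: Frobenius_maximal_sol frobK maxAq solAq.
Qed.

Lemma sol_sub_solubilizer (gT : finGroupType) (G H : {group gT}) x :
  H \subset G -> solvable H -> x \in H -> H \subset solubilizer G x.
Proof.
move=> sHG solH Hx; apply/subsetP=> g Hg; rewrite inE (subsetP sHG) //=.
by apply: solvableS solH; rewrite gen_subG subUset !sub1set Hx.
Qed.

Theorem theorem1p2 (gT : finGroupType) (G : {group gT}) :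
  (exists2 x, x \in G & {in solubilizer G x &, forall g h, commute g h}) ->
  abelian G.
Proof.
have [n] := ubnP #|G|; elim: n G => // n IHn G /ltnSE leGn [x Gx cSol].
have abel_sol (H : {group gT}) :
  H \subset G -> solvable H -> x \in H -> abelian H.
  move=> sHG solH Hx; have sHS := sol_sub_solubilizer sHG solH Hx.
  by apply/centsP=> g Hg h Hh; apply: cSol; apply: (subsetP sHS).
suff solG : solvable G by exact: abel_sol Gx.
(* The solubilizer of [x] in [H] lies in the one in [G], so the hypothesis passes to [H] and
   induction applies. *)
have abel_proper (H : {group gT}) : H \proper G -> x \in H -> abelian H.
  move=> prHG Hx; apply: IHn; first exact: leq_trans (proper_card prHG) leGn.
  exists x => // g h; rewrite !inE => /andP[Hg solg] /andP[Hh solh].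
  have sHG := proper_sub prHG.
  by apply: cSol; rewrite inE ?(subsetP sHG).
have Cx : x \in 'C_G[x] by rewrite inE Gx cent1id.
(* If [x] is central, every pair [x], [g] generates an abelian group, so the solubilizer is all of
   [G]. *)
have [/setIidPl sGC | prCG] := eqVproper (subsetIl G 'C[x]).
  have sGS : G \subset solubilizer G x.
    apply/subsetP=> g Gg; rewrite inE Gg abelian_sol // abelian_gen.
    have /cent1P cxg := subsetP sGC g Gg.
    by apply/centsP=> _ /set2P[] -> _ /set2P[] ->.
  by apply/abelian_sol/centsP=> g Gg h Gh; apply: cSol; apply: (subsetP sGS).
apply: (@abelian_maximal_sol _ G 'C_G[x]%G); last exact: abel_proper.
apply/maxgroupP; split=> // H prHG sCH.
(* A proper [H] above the centraliser contains [x], so it is abelian and centralises [x]. *)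
have Hx := subsetP sCH x Cx; apply/eqP; rewrite eqEsubset sCH andbT.
rewrite subsetI proper_sub //= sub_cent1.
exact: subsetP (abel_proper H prHG Hx) x Hx.
Qed.
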